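(* If $G$ is an abelian Polish group and $A\subseteq G$ is an $F_\sigma$ Haar meager subset, then $A$ is strongly Haar meager.
   Context: For an abelian Polish group $(G,+)$: a set $A\subseteq G$ is \emph{Haar meager} if there are a Borel set $B\supseteq A$, a nonempty compact metric space $K$ and a continuous function $f:K\to G$ such that $f^{-1}(B+g)$ is meager in $K$ for every $g\in G$. A set $A\subseteq G$ is \emph{strongly Haar meager} if there are a Borel set $B\supseteq A$ and a nonempty compact set $C\subseteq G$ such that $(B+g)\cap C$ is meager in $C$ for every $g\in G$. *)

(* Defs.v *)
From mathcomp Require Import all_boot all_order all_algebra.
From mathcomp Require Import all_classical all_reals all_analysis.

Set Implicit Arguments.
Unset Strict Implicit.
Unset Printing Implicit Defensive.

Import Order.TTheory GRing.Theory Num.Theory.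

Local Open Scope classical_set_scope.
Local Open Scope ring_scope.

Section Polish.
Context {R : realType} {T : topologicalType}.
Implicit Type d : T -> T -> R.

Definition is_distance d :=
  [/\ forall x, d x x = 0,
      forall x y, d x y = 0 -> x = y,
      forall x y, d x y = d y x &
      forall x y z, d x z <= d x y + d y z].

Definition induces_topology d :=
  forall x, nbhs x = filter_from [set e : R | 0 < e]
                                 (fun e => [set y | d x y < e]).

Definition cauchy_seq d (u : nat -> T) :=
  forall e, 0 < e ->
    exists N, forall m n, (N <= m)%N -> (N <= n)%N -> d (u m) (u n) < e.

Definition complete_distance d :=
  forall u : nat -> T, cauchy_seq d u -> exists l : T, u @ \oo --> l.

Definition separable := exists2 D : set T, countable D & dense D.

End Polish.

Definition polish (R : realType) (T : topologicalType) :=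
  @separable T /\
  exists d : T -> T -> R,
    [/\ is_distance d, induces_topology d & complete_distance d].

Section Category.
Context {T : topologicalType}.
Implicit Type A : set T.

Definition borel A := <<s @open T >> A.

Definition nowhere_dense A := interior (closure A) = set0.

Definition meager A :=
  exists2 F : nat -> set T,
    (forall n, nowhere_dense (F n)) & A `<=` \bigcup_n F n.

End Category.

Definition translate (G : zmodType) (B : set G) (g : G) : set G :=
  [set b + g | b in B].

Definition haar_meager (R : realType) (G : topologicalZmodType) (A : set G) :=
  exists2 B : set G, borel B /\ A `<=` B &
    exists (K : metricType R) (f : K -> G),
      [/\ [set: K] !=set0, compact [set: K], continuous f &
          forall g, meager (f @^-1` translate B g)].

(* [set_type C] carries the topology induced from [G], and the preimage of
   [translate B g] under [set_val] is its trace on [C]. *)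
Definition strongly_haar_meager (G : topologicalZmodType) (A : set G) :=
  exists2 B : set G, borel B /\ A `<=` B &
    exists C : set G,
      [/\ C !=set0, compact C &
          forall g, meager ((set_val : set_type C -> G) @^-1` translate B g)].

(* Main.v *)
(** Write [A] as a countable union of closed sets [F n] and let [f : K -> G]
    witness that [A] is Haar meager; then [f @` K] witnesses that [A] is
    strongly Haar meager.  Indeed the preimage under [f] of a translate of
    [F n] is closed and meager in the compact space [K], so it has empty
    interior by Baire's theorem.  A relatively open subset of [f @` K] contained
    in that translate would have an open preimage in [K], hence is empty. *)

Require Import Defs.
From mathcomp Require Import all_boot all_order all_algebra.
From mathcomp Require Import all_classical all_reals all_analysis.
From mathcomp Require Import borel_hierarchy.

Set Implicit Arguments.
Unset Strict Implicit.
Unset Printing Implicit Defensive.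

Import GRing.Theory.

Local Open Scope classical_set_scope.
Local Open Scope ring_scope.

Section Category.
Context {X : topologicalType}.

(** The inductive step of the Baire construction: if [U] lay inside [closure F], it would lie in its
    empty interior; regularity then shrinks the open set left over. *)
Lemma nowhere_dense_shrink (F U : set X) : regular_space X ->
    nowhere_dense F -> open U -> U !=set0 ->
  exists V, [/\ open V, V !=set0 & closure V `<=` U `\` closure F].
Proof.
move=> rX F0 oU [x Ux].
have [y [Uy Fy]] : (U `\` closure F) !=set0.
  apply: contrapT => /nonemptyPn; rewrite setD_eq0 (open_subsetE _ oU) F0.
  by move=> /(_ x Ux).
have oUF : open (U `\` closure F).
  by apply: openI => //; apply: closed_openC; exact: closed_closure.
have [W Wy WU] := rX y _ (open_nbhs_nbhs (conj oUF (conj Uy Fy))).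
exists (interior W); split; first exact: open_interior.
- by exists y.
- by apply: subset_trans WU; apply: closure_subset; exact: interior_subset.
Qed.

(** Baire's theorem: shrinking [interior A] past each [F n] in turn gives nested open sets, and by
    compactness some point lies in all their closures, hence in [A] but in no [F n]. *)
Lemma compact_meager_interior (A : set X) : regular_space X ->
  compact [set: X] -> meager A -> interior A = set0.
Proof.
move=> rX cX [F F0 AF]; apply/eqP/negPn/negP => /set0P A0.
pose P (U : set X) := open U /\ U !=set0.
(* Guarding by [P] makes the choice total, with [set0] as junk value. *)
have /choice[s sP] (nU : nat * set X) : exists V, P nU.2 ->
    P V /\ closure V `<=` nU.2 `\` closure (F nU.1).
  have [[oU U0]|] := pselect (P nU.2); last by exists set0.
  by have [V [oV V0 VU]] := nowhere_dense_shrink rX (F0 nU.1) oU U0; exists V.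
pose U := nat_rect (fun=> set X) (interior A) (fun n V => s (n, V)).
have PU n : P (U n).
  elim: n => [|n IHn]; first by split=> //; exact: open_interior.
  by have [] := sP (n, U n) IHn.
have SU n : closure (U n.+1) `<=` U n `\` closure (F n).
  by have [] := sP (n, U n) (PU n).
have leU m n : (m <= n)%N -> U n `<=` U m.
  elim: n => [|n IHn]; first by rewrite leqn0 => /eqP ->.
  rewrite leq_eqVlt => /orP[/eqP -> //|/IHn Unm] x Ux.
  by apply: Unm; have [] := SU n x (subset_closure Ux).
have /choice[u uU] n : exists x, U n x by have [] := PU n.
(* A cluster point of [u] is in [closure (U n)], since [u] stays in [U n] from index [n] on. *)
have [p [_ cp]] := cX (u @ \oo) _ (filterT : (u @ \oo) setT).
have Up n : closure (U n) p.
  move=> W Wp; apply: cp Wp.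
  by exists n => // m /= /leU; apply.
have [n _ Fnp] : (\bigcup_n F n) p.
  (* [p] is only known to be in closures, so membership in [U 0] comes from [closure (U 1)]. *)
  by apply: AF; apply: interior_subset; have [] := SU 0%N p (Up 1%N).
by have [_ []] := SU n p (Up n.+1); exact: subset_closure.
Qed.

End Category.

Lemma image_nowhere_dense (X Y : topologicalType) (f : X -> Y) (B : set Y) :
  continuous f -> closed B -> interior (f @^-1` B) = set0 ->
  nowhere_dense ((set_val : set_type (range f) -> Y) @^-1` B).
Proof.
move=> cf cB fB0; rewrite /nowhere_dense.
have cv : continuous (set_val : set_type (range f) -> Y).
  exact: initial_continuous.
rewrite (_ : closure _ = set_val @^-1` B); last first.
  by apply/esym/closure_id; apply: closed_comp cB => z _; exact: cv.
(* Open sets of the subtype are traces of open sets [W] of [Y]. *)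
rewrite -subset0 => y; rewrite /interior/= nbhsE => -[_ [[W oW <-] Wy] WB].
have [x _ fxy] : range f (set_val y) by exact/set_mem/(valP y).
suff : interior (f @^-1` B) x by rewrite fB0.
rewrite /interior/= nbhsE; exists (f @^-1` W); first split.
- exact: open_comp.
- by rewrite /= fxy.
- move=> z /= Wfz.
  have fz : f z \in range f by apply/mem_set; exists z.
  exact: (WB (SigSub fz)).
Qed.

Lemma translate_closed (G : topologicalZmodType) (B : set G) (g : G) :
  closed B -> closed (translate B g).
Proof.
move=> cB; rewrite (_ : translate B g = (fun x => x - g) @^-1` B); last first.
  apply/seteqP; split=> [_ [b Bb <-]|x /= Bx]; first by rewrite /= addrK.
  by exists (x - g) => //; rewrite subrK.
apply: closed_comp cB => x _.
apply: (@continuous_comp _ _ _ (fun x : G => (x, g)) (fun z => z.1 - z.2)).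
  by apply: cvg_pair; [exact: cvg_id|exact: cvg_cst].
exact: sub_continuous.
Qed.

Lemma Fsigma_borel (T : topologicalType) (A : set T) : Fsigma A -> borel A.
Proof.
move=> [F cF ->]; apply: sigma_algebra_bigcup => n.
rewrite -[F n]setCK -setTD; apply: sigma_algebraCD.
by apply: sub_sigma_algebra; exact: closed_openC.
Qed.

Theorem theorem5p7 (R : realType) (G : topologicalZmodType)
    (hG : polish R G) (A : set G) (hF : Fsigma A) (hA : haar_meager R A) :
  strongly_haar_meager A.
Proof.
have bA := Fsigma_borel hF.
case: hF bA hA => F cF -> bA [B [_ AB] [K [f [[x _] cK cf fB]]]].
(* The Borel hull is [A] itself, as the argument needs closed pieces; [B] only serves to make the
   preimages of their translates meager. *)
exists (\bigcup_n F n); first by split; [exact: bA|exact: subset_refl].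
exists (range f); split.
- by exists (f x), x.
- by apply: continuous_compact => //; exact: continuous_subspaceT.
move=> g; exists (fun n => set_val @^-1` translate (F n) g).
  move=> n; apply: image_nowhere_dense => //; first exact: translate_closed.
  apply: compact_meager_interior => //; first exact: uniform_regular.
  have [N N0 BN] := fB g; exists N => // z [b Fb bz].
  by apply: BN; exists b => //; apply: AB; exists n.
by move=> y [b [n _ Fb] bz]; exists n => //; exists b.
Qed.
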